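(* Let $d\ge 1$ and let $\phi,\phi':\mathscr K^d\to\mathbb Z$ be integer-valued $\sigma$-continuous valuations that coincide on singletons: $\phi(\{x\})=\phi'(\{x\})$ for every $x\in\mathbb R^d$. Then $\phi=\phi'$.
   Context: $\mathscr K^d$ is the family of all compact convex subsets of $\mathbb R^d$, including the empty set. A valuation is a map $\phi$ on $\mathscr K^d$ with $\phi(\emptyset)=0$ and $\phi(K\cup L)+\phi(K\cap L)=\phi(K)+\phi(L)$ for all $K,L\in\mathscr K^d$ such that $K\cup L$ is convex. It is $\sigma$-continuous if $\phi(K_n)\to\phi(K)$ for every sequence $(K_n)$ in $\mathscr K^d$ with $K_n\downarrow K$ (decreasing with intersection $K$). *)

(* Defs.v *)
From HB Require Import structures.
From mathcomp Require Import all_boot all_order all_algebra.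
From mathcomp Require Import all_classical all_reals all_analysis.

Set Implicit Arguments.
Unset Strict Implicit.
Unset Printing Implicit Defensive.

Import Order.TTheory GRing.Theory Num.Theory.
Import numFieldNormedType.Exports.

Local Open Scope classical_set_scope.
Local Open Scope ring_scope.

Record compact_convex (R : realType) (d : nat) := CompactConvex {
  cc_set :> set 'rV[R]_d;
  cc_compact : compact cc_set;
  cc_convex : convex_set (cc_set : set (convex_lmodType 'rV[R]_d)) }.

Section compact_convex_sets.
Context (R : realType) (d : nat).
Implicit Types (K L : compact_convex R d) (x : 'rV[R]_d).

Lemma cc_inj K L : K = L :> set _ -> K = L.
Proof.
case: K L => [A cA vA] [B cB vB] /= AB; case: B / AB cB vB => cB vB.
by congr CompactConvex; exact: Prop_irrelevance.
Qed.

Lemma convex_set_set0 : convex_set (set0 : set (convex_lmodType 'rV[R]_d)).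
Proof. by move=> x y t; rewrite inE. Qed.

Lemma convex_set_set1 x : convex_set ([set x] : set (convex_lmodType 'rV[R]_d)).
Proof. by move=> y z t; rewrite !inE => -> ->; rewrite convmm. Qed.

Lemma convex_setI_cc K L :
  convex_set (K `&` L : set (convex_lmodType 'rV[R]_d)).
Proof.
move=> x y t; rewrite !inE => -[Kx Lx] [Ky Ly].
by split; apply/set_mem; apply: cc_convex; exact/mem_set.
Qed.

Lemma compact_setI_cc K L : compact (K `&` L).
Proof.
apply: compact_closedI; first exact: cc_compact.
by apply: compact_closed; [exact: norm_hausdorff|exact: cc_compact].
Qed.

Lemma compact_setU_cc K L : compact (K `|` L).
Proof. by apply: compactU; exact: cc_compact. Qed.

Definition cc0 : compact_convex R d :=
  CompactConvex (@compact0 'rV[R]_d) convex_set_set0.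

Definition cc1 x : compact_convex R d :=
  CompactConvex (@compact_set1 'rV[R]_d x) (convex_set_set1 (x := x)).

Definition ccI K L : compact_convex R d :=
  CompactConvex (@compact_setI_cc K L) (@convex_setI_cc K L).

Definition ccU K L
    (KL : convex_set (K `|` L : set (convex_lmodType 'rV[R]_d))) :
    compact_convex R d :=
  CompactConvex (@compact_setU_cc K L) KL.

End compact_convex_sets.

Arguments cc0 {R d}.

Definition valuation (R : realType) (d : nat) (V : zmodType)
    (phi : compact_convex R d -> V) : Prop :=
  phi cc0 = 0 /\
  forall (K L : compact_convex R d)
      (KL : convex_set (K `|` L : set (convex_lmodType 'rV[R]_d))),
    phi (ccU KL) + phi (ccI K L) = phi K + phi L.

Definition decreases_to (R : realType) (d : nat)
    (K_ : nat -> compact_convex R d) (K : compact_convex R d) : Prop :=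
  nonincreasing_seq (fun n => K_ n : set 'rV[R]_d) /\
  \bigcap_n (K_ n : set 'rV[R]_d) = K.

Definition sigma_continuous (R : realType) (d : nat) (T : topologicalType)
    (phi : compact_convex R d -> T) : Prop :=
  forall (K_ : nat -> compact_convex R d) (K : compact_convex R d),
    decreases_to K_ K -> phi (K_ n) @[n --> \oo] --> phi K.

(* Main.v *)
Require Import Defs.
From mathcomp Require Import all_boot all_order all_algebra.
From mathcomp Require Import all_classical all_reals all_analysis.
From mathcomp Require Import lra.

Import Order.TTheory GRing.Theory Num.Theory.
Import numFieldNormedType.Exports.

Local Open Scope classical_set_scope.
Local Open Scope ring_scope.

(** The difference psi of the two valuations is a sigma-continuous valuation
    vanishing on singletons. If psi K <> 0, cut K by a hyperplane: additivity
    makes psi nonzero on one of the two halves or on their intersection, which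
    lies in both halves, so no induction on the dimension is needed. Halving
    all coordinates again and again gives a decreasing sequence on which
    psi <> 0 and whose intersection is a single point x. Since psi takes
    integer values, this contradicts psi (K_ n) --> psi [set x] = 0. *)

(** Choose a point in each set. The resulting sequence is eventually in every [K_ n], so a cluster
    point of it, which compactness of [K_ 0] provides, lies in every [K_ n], these being closed in a
    Hausdorff space. *)
Lemma nested_compact_neq0 {T : topologicalType} (K_ : nat -> set T) :
  hausdorff_space T -> (forall n, compact (K_ n)) ->
  (forall n, K_ n !=set0) -> (forall n, K_ n.+1 `<=` K_ n) ->
  \bigcap_n K_ n !=set0.
Proof.
move=> hT cK K0 KS.
have Kle n m : (n <= m)%N -> K_ m `<=` K_ n.
  by move=> nm; apply/subsetPset; apply: (nonincreasing_seqP K_).1 => // k;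
    apply/subsetPset.
have [u Ku] := choice K0.
have uK n : (u @ \oo) (K_ n).
  by exists n => // m /= nm; apply: Kle nm _ (Ku m).
have [p [_ clp]] := cK 0%N (u @ \oo) _ (uK 0%N).
exists p => n _; apply: compact_closed (hT) (cK n) _ _ => B Bp.
exact: clp.
Qed.

Lemma compact_convexI_closed {R : realType} {d : nat} (K : compact_convex R d)
    (H : set 'rV[R]_d) :
  closed H -> convex_set (H : set (convex_lmodType 'rV[R]_d)) ->
  exists L : compact_convex R d, L = K `&` H :> set _.
Proof.
move=> cH vH; have cKH := compact_closedI (@cc_compact _ _ K) cH.
suff vKH : convex_set (K `&` H : set (convex_lmodType 'rV[R]_d)).
  by exists (CompactConvex cKH vKH).
move=> x y t; rewrite !inE => -[Kx Hx] [Ky Hy].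
by split; apply/set_mem; [apply: cc_convex|apply: vH]; exact/mem_set.
Qed.

Lemma closed_coord_itv {R : realType} {d : nat} (i : 'I_d) (c r : R) :
  closed [set x : 'rV[R]_d | `|x 0 i - c| <= r].
Proof.
rewrite (_ : mkset _ = (fun x : 'rV[R]_d => x 0 i) @^-1` `[c - r, c + r]).
  by apply: (continuous_closedP _).1 => //; [exact: coord_continuous|
    exact: interval_closed].
by apply/seteqP; split=> x /=; rewrite in_itv /= ler_distl.
Qed.

Lemma convex_coord_itv {R : realType} {d : nat} (i : 'I_d) (c r : R) :
  convex_set ([set x | `|x 0 i - c| <= r] : set (convex_lmodType 'rV[R]_d)).
Proof.
move=> x y t; rewrite !inE /= !mxE !ler_norml /unstable.onem.
have : 0 <= t%:num <= 1 by rewrite ge0 le1.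
move: t%:num (x 0 i) (y 0 i) => s a b.
by move=> /andP[s0 s1] /andP[a1 a2] /andP[b1 b2]; apply/andP; split; nra.
Qed.

Section shrinking.
Context {R : realType} {d : nat} {V : zmodType}.
Context {psi : compact_convex R d -> V} (psi_val : valuation psi).
Implicit Types (K L : compact_convex R d) (H : set 'rV[R]_d).

Lemma valuation_cover_neq0 K H1 H2 :
  closed H1 -> convex_set (H1 : set (convex_lmodType 'rV[R]_d)) ->
  closed H2 -> convex_set (H2 : set (convex_lmodType 'rV[R]_d)) ->
  K `<=` H1 `|` H2 -> psi K != 0 ->
  exists L, [/\ L `<=` K, psi L != 0 & L `<=` H1 \/ L `<=` H2].
Proof.
move=> c1 v1 c2 v2 K12 psiK.
have [K1 K1E] := compact_convexI_closed K H1 c1 v1.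
have [K2 K2E] := compact_convexI_closed K H2 c2 v2.
have K12E : K1 `|` K2 = K.
  by rewrite K1E K2E -setIUr; apply/setIidPl.
have vU : convex_set (K1 `|` K2 : set (convex_lmodType 'rV[R]_d)).
  by rewrite K12E; exact: cc_convex.
have UE : ccU vU = K by exact: cc_inj.
have := psi_val.2 K1 K2 vU; rewrite UE => psiE.
have [psi1|psi1] := eqVneq (psi K1) 0; last first.
  by exists K1; split=> //; [|left]; rewrite K1E; move=> x [].
have [psi2|psi2] := eqVneq (psi K2) 0; last first.
  by exists K2; split=> //; [|right]; rewrite K2E; move=> x [].
(* Both pieces now have value 0, so additivity reduces to [psi K = psi (ccI K1 K2)]. *)
exists (ccI K1 K2); split=> /=; first by rewrite K1E => x [[]].
  apply: contraNneq psiK => psiI; move: psiE.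
  by rewrite psi1 psi2 psiI !addr0 => ->.
by left; rewrite K1E => x [[]].
Qed.

(** The centre [c] is left existential because it moves at each halving; only the radius has to be
    tracked. *)
Definition coord_radius (A : set 'rV[R]_d) (i : 'I_d) (r : R) :=
  exists c, forall x, A x -> `|x 0 i - c| <= r.

Lemma coord_radius_sub A B i r :
  A `<=` B -> coord_radius B i r -> coord_radius A i r.
Proof. by move=> AB [c Bc]; exists c => x /AB/Bc. Qed.

Lemma coord_radius_exists K : exists r, forall i, coord_radius K i r.
Proof.
suff bnd i : exists r, coord_radius K i r.
  have [r Kr] := choice bnd; exists (\big[Num.max/0]_i r i) => i.
  by have [c Kc] := Kr i; exists c => x /Kc/le_trans; apply; exact: le_bigmax.
have /compact_bounded[M [_ Mb]] : compact ((fun x : 'rV[R]_d => x 0 i) @` K).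
  apply: continuous_compact; last exact: cc_compact.
  exact/continuous_subspaceT/coord_continuous.
(* [compact_bounded] yields a bound only for reals strictly above [M], hence [M + 1]. *)
exists (M + 1), 0 => x Kx; rewrite subr0.
by apply: Mb; [rewrite ltrDl|exists x].
Qed.

Lemma valuation_halve_coord K i r : psi K != 0 -> coord_radius K i r ->
  exists L, [/\ L `<=` K, psi L != 0 & coord_radius L i (r / 2)].
Proof.
move=> psiK [c Kc].
(* The slabs centred at [c - r / 2] and [c + r / 2] cover [K]: they are its two sides with respect
   to the hyperplane where coordinate [i] equals [c]. *)
pose H c' := [set x : 'rV[R]_d | `|x 0 i - c'| <= r / 2].
have [||||x /Kc|L [LK psiL LH]] :=
    valuation_cover_neq0 K (H (c - r / 2)) (H (c + r / 2)) _ _ _ _ _ psiK;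
  try exact: closed_coord_itv; try exact: convex_coord_itv.
  rewrite /H /= !ler_norml => /andP[x1 x2].
  have [xc|cx] := leP (x 0 i) c; [left|right]; apply/andP; split; lra.
by exists L; split=> //; case: LH => LH; [exists (c - r / 2)|exists (c + r / 2)].
Qed.

Lemma valuation_halve K r : psi K != 0 -> (forall i, coord_radius K i r) ->
  exists L, [/\ L `<=` K, psi L != 0 & forall i, coord_radius L i (r / 2)].
Proof.
move=> psiK Kr.
(* Induction on the list of coordinates already halved: later cuts keep the earlier bounds, since
   [coord_radius] passes to subsets. *)
suff /(_ (enum 'I_d))[L [LK psiL Lr]] : forall s : seq 'I_d, exists L,
    [/\ L `<=` K, psi L != 0 & {in s, forall i, coord_radius L i (r / 2)}].
  by exists L; split=> // i; apply: Lr; rewrite mem_enum.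
elim=> [|i s [L [LK psiL Lr]]]; first by exists K; split.
have [M [ML psiM Mr]] :=
  valuation_halve_coord L i r psiL (coord_radius_sub _ _ _ _ LK (Kr i)).
exists M; split=> //; first exact: subset_trans LK.
move=> j; rewrite inE => /predU1P[->//|/Lr]; exact: coord_radius_sub.
Qed.

Lemma valuation_shrink K : psi K != 0 ->
  exists (K_ : nat -> compact_convex R d) (x : 'rV[R]_d),
    decreases_to K_ (cc1 x) /\ forall n, psi (K_ n) != 0.
Proof.
move=> psiK; have [r Kr] := coord_radius_exists K.
(* The radius is carried along with the set, so that dependent choice also fixes its value at each
   stage. *)
pose P (p : compact_convex R d * R) :=
  psi p.1 != 0 /\ forall i, coord_radius p.1 i p.2.
pose S (p q : {p | P p}) :=
  (sval q).1 `<=` (sval p).1 /\ (sval q).2 = (sval p).2 / 2.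
have stepS p : {q | S p q}.
  apply: cid; case: p => -[L s] [/= psiL Ls].
  have [M [ML psiM Ms]] := valuation_halve L s psiL Ls.
  by exists (exist P (M, s / 2) (conj psiM Ms)).
have [f [f0 fS]] := dependent_choice stepS (exist P (K, r) (conj psiK Kr)).
pose K_ n := (sval (f n)).1.
have psiK_ n : psi (K_ n) != 0 by case: (svalP (f n)).
have KS n : K_ n.+1 `<=` K_ n by case: (fS n).
have radE n : (sval (f n)).2 = geometric r 2^-1 n.
  elim: n => [|n IHn]; first by rewrite f0 /= expr0 mulr1.
  by have [_ ->] := fS n; rewrite IHn /= exprSr mulrA.
have K_r n i : coord_radius (K_ n) i (geometric r 2^-1 n).
  by rewrite -radE; case: (svalP (f n)).
have [||n|//|x Kx] := @nested_compact_neq0 _ (fun n => K_ n : set 'rV[R]_d).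
- exact: norm_hausdorff.
- by move=> n; exact: cc_compact.
(* An empty [K_ n] would have value 0. *)
- apply/set0P; apply: contraNneq (psiK_ n) => Kn0.
  by rewrite (_ : K_ n = cc0) ?psi_val.1//; exact: cc_inj.
exists K_, x; split=> //; split.
  by apply/nonincreasing_seqP => n; apply/subsetPset.
apply/seteqP; split=> [y Ky|y /= ->//]; apply/rowP => i.
(* Both points are within the [n]-th radius of a common centre, which explains the factor 2; the
   bound tends to 0 and forces [y = x]. *)
have xy n : `|y 0 i - x 0 i| <= geometric (r * 2) 2^-1 n.
  have [c Kc] := K_r n i; have := Kc x (Kx n I); have := Kc y (Ky n I).
  rewrite /= !ler_norml mulrAC => /andP[y1 y2] /andP[x1 x2].
  by apply/andP; split; lra.
apply/eqP; rewrite -subr_eq0 -normr_le0.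
have half1 : `|2^-1 : R| < 1 by rewrite ger0_norm ?invf_lt1 ?ltr1n.
apply: (@ler_cvg_to _ _ _ _ (fun=> `|y 0 i - x 0 i|) _ _ _ (cvg_cst _) (cvg_geometric (r * 2) half1)).
exact: nearW.
Qed.

End shrinking.

Lemma int_valuation_eq0 {R : realType} {d : nat}
    (psi : compact_convex R d -> int) :
  valuation psi -> sigma_continuous (fun K => (psi K)%:~R : R) ->
  (forall x, psi (cc1 x) = 0) -> forall K, psi K = 0.
Proof.
move=> psi_val psi_cont psi1 K; apply/eqP/negPn/negP.
move=> /(valuation_shrink psi_val)[K_ [x [Kx psiK]]].
(* Convergence to 0 with tolerance 1 gives some [n] with [psi (K_ n)] of absolute value below 1,
   whereas a nonzero integer has absolute value at least 1. *)
have := psi_cont _ _ Kx; rewrite psi1 => /cvgr0_norm_lt/(_ _ ltr01)[n _ /(_ n)].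
move=> /(_ (leqnn n)) /=; rewrite -intr_norm ltrz1.
by rewrite ltNge -gtz0_ge1 normr_gt0 psiK.
Qed.

(* Convergence of the integer values is convergence in the reals. *)
Theorem proposition2p3 (R : realType) (d : nat) (d_ge1 : (1 <= d)%N)
    (phi phi' : compact_convex R d -> int)
    (phi_val : valuation phi) (phi'_val : valuation phi')
    (phi_cont : sigma_continuous (fun K => (phi K)%:~R : R))
    (phi'_cont : sigma_continuous (fun K => (phi' K)%:~R : R))
    (phi_singleton : forall x : 'rV[R]_d, phi (cc1 x) = phi' (cc1 x)) :
  phi = phi'.
Proof.
apply/funext => K; apply/eqP; rewrite -subr_eq0; apply/eqP.
apply: (@int_valuation_eq0 R d (fun K => phi K - phi' K)).
- split=> [|L M LM]; first by rewrite phi_val.1 phi'_val.1 subrr.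
  by rewrite addrACA phi_val.2 -opprD phi'_val.2 opprD addrACA.
- move=> K_ L KL; rewrite intrB (_ : (fun n => _) =
    (fun n => (phi (K_ n))%:~R - (phi' (K_ n))%:~R)); last first.
    by apply/funext => n; rewrite intrB.
  by apply: cvgB; [exact: phi_cont|exact: phi'_cont].
- by move=> x; rewrite phi_singleton subrr.
Qed.
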